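(* Let $n \geq 2$ and let $m$ be an integer with $\binom{n}{2} - \lfloor \frac{n^2}{4} \rfloor \leq m \leq \binom{n}{2}$. Let $H$ be any graph formed from the disjoint union $K_{\lceil n/2 \rceil} \cup K_{\lfloor n/2 \rfloor}$ by adding in any $m - \left(\binom{n}{2} - \lfloor \frac{n^2}{4} \rfloor\right)$ edges. Then $H$ is optimally-least in $\mathcal{S}_{n,m}$ for the independence polynomial, and its independence polynomial is $$I(H,x) = 1 + nx + \left(\binom{n}{2} - m\right)x^2.$$
   Context: All graphs are finite and simple. $\mathcal{S}_{n,m}$ denotes the set of simple graphs with $n$ vertices and $m$ edges. The independence polynomial of a graph $G$ is $I(G,x) = \sum_{j} i_j x^j$, where $i_j$ is the number of independent sets of vertices of $G$ of cardinality $j$ (including the empty set). A graph $H \in \mathcal{S}_{n,m}$ is optimally-least for the independence polynomial if $I(H,x) \leq I(G,x)$ for all $G \in \mathcal{S}_{n,m}$ and all real $x \geq 0$. $K_r$ is the complete graph on $r$ vertices. Added edges join pairs of distinct vertices that are not already adjacent. *)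

(* Defs.v *)
From HB Require Import structures.
From mathcomp Require Import all_boot all_order all_algebra.
From mathcomp Require Import reals.

Set Implicit Arguments.
Unset Strict Implicit.
Unset Printing Implicit Defensive.

Import Order.TTheory GRing.Theory Num.Theory.

Record sgraph := SGraph {
  vertex :> finType;
  adj : rel vertex;
  adj_sym : symmetric adj;
  adj_irrefl : irreflexive adj
}.

Definition edges (G : sgraph) : {set {set G}} :=
  [set [set p.1; p.2] | p in [pred p : G * G | adj p.1 p.2]].

(* Pairs of distinct vertices that are not adjacent. *)
Definition nonedges (G : sgraph) : {set {set G}} :=
  [set e : {set G} | #|e| == 2] :\: edges G.

(* Vertices are not labelled by a fixed set: any n-element finite vertex type
   is allowed. *)
Definition in_S (n m : nat) (G : sgraph) : Prop :=
  #|G| = n /\ #|edges G| = m.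

Definition graph_iso (G H : sgraph) : Prop :=
  exists2 f : G -> H, bijective f & forall x y, adj (f x) (f y) = adj x y.

Section Complete.
Variable r : nat.

Definition complete_adj : rel 'I_r := [rel x y | x != y].

Lemma complete_adj_sym : symmetric complete_adj.
Proof. by move=> x y; rewrite /complete_adj /= eq_sym. Qed.

Lemma complete_adj_irrefl : irreflexive complete_adj.
Proof. by move=> x; rewrite /complete_adj /= eqxx. Qed.

Definition complete_graph : sgraph :=
  SGraph complete_adj_sym complete_adj_irrefl.
End Complete.

Section DisjointUnion.
Variables G H : sgraph.

Definition union_adj : rel (G + H)%type := fun u v =>
  match u, v with
  | inl x, inl y => adj x y
  | inr x, inr y => adj x y
  | _, _ => false
  end.

Lemma union_adj_sym : symmetric union_adj.
Proof. by move=> [x|x] [y|y] //=; apply: adj_sym. Qed.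

Lemma union_adj_irrefl : irreflexive union_adj.
Proof. by move=> [x|x] /=; apply: adj_irrefl. Qed.

Definition disjoint_union : sgraph := SGraph union_adj_sym union_adj_irrefl.
End DisjointUnion.

Section AddEdges.
Variables (G : sgraph) (F : {set {set G}}).

Definition added_adj : rel G :=
  [rel x y | adj x y || (x != y) && ([set x; y] \in F)].

Lemma added_adj_sym : symmetric added_adj.
Proof. by move=> x y; rewrite /added_adj /= adj_sym eq_sym setUC. Qed.

Lemma added_adj_irrefl : irreflexive added_adj.
Proof. by move=> x; rewrite /added_adj /= adj_irrefl eqxx. Qed.

Definition add_edges : sgraph := SGraph added_adj_sym added_adj_irrefl.
End AddEdges.

(* H is, up to isomorphism, G with k new edges. *)
Definition formed_by_adding (G : sgraph) (k : nat) (H : sgraph) : Prop :=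
  exists F : {set {set G}},
    [/\ F \subset nonedges G, #|F| = k & graph_iso (add_edges F) H].

Definition independent (G : sgraph) (A : {set G}) : bool :=
  [forall x in A, forall y in A, ~~ adj x y].

Definition indep_count (G : sgraph) (j : nat) : nat :=
  #|[set A : {set G} | independent A && (#|A| == j)]|.

Definition indep_poly (R : nzRingType) (G : sgraph) : {poly R} :=
  (\poly_(j < #|G|.+1) (indep_count G j)%:R)%R.

Definition optimally_least (R : realType) (n m : nat) (H : sgraph) : Prop :=
  in_S n m H /\
  forall G : sgraph, in_S n m G ->
  forall x : R, (0 <= x -> (indep_poly R H).[x] <= (indep_poly R G).[x])%R.

(* Main.v *)
Require Import Defs.
From mathcomp Require Import all_boot all_order all_algebra.
From mathcomp Require Import reals.
From mathcomp Require Import zify ring.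
Import Order.TTheory GRing.Theory Num.Theory.

(** Every graph with [n] vertices and [m] edges has independence polynomial
    [1 + n x + ('C(n, 2) - m) x^2 + ...], because an independent pair is the
    same thing as a nonedge ([indep_count2]).  The later coefficients are
    nonnegative, so a graph in which they all vanish is least at each [x >= 0]
    ([le_indep_poly]).  They vanish as soon as the vertices are covered by two
    cliques, since an independent set meets a clique at most once
    ([indep_count_two_cliques]); adding edges to two disjoint cliques keeps
    such a cover.

    What remains is that [H] really has [m] edges.  The nonedges of
    [K_a + K_b] are the pairs with one end on each side, so there are [a * b]
    of them, which is [n ^ 2 %/ 4] when [a] and [b] are the two halves of [n];
    adding [k] edges removes [k] nonedges.  The isomorphism in the
    construction of [H] is absorbed by the invariance of the numbers of
    independent sets ([indep_count_iso]). *)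

Lemma mem_edges_pair (G : sgraph) (x y : G) :
  ([set x; y] \in edges G) = adj x y.
Proof.
apply/imsetP/idP => [[[u v] /= adj_uv eq_xy] | adj_xy]; last first.
  by exists (x, y).
have neq_uv : u != v by apply: contraTneq adj_uv => ->; rewrite inE adj_irrefl.
rewrite inE /= in adj_uv.
have: u \in [set x; y] by rewrite eq_xy !inE eqxx.
have: v \in [set x; y] by rewrite eq_xy !inE eqxx orbT.
rewrite !inE => /orP[] /eqP Ev /orP[] /eqP Eu; move: neq_uv adj_uv;
  rewrite Eu Ev ?eqxx // => _.
by rewrite adj_sym.
Qed.

Lemma edges_sub_pairs (G : sgraph) :
  edges G \subset [set e : {set G} | #|e| == 2].
Proof.
apply/subsetP => e /imsetP[[u v] /= adj_uv ->]; rewrite inE cards2.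
by case: (eqVneq u v) adj_uv => // ->; rewrite inE /= adj_irrefl.
Qed.

Lemma card_edges_nonedges (G : sgraph) :
  #|edges G| + #|nonedges G| = 'C(#|G|, 2).
Proof.
rewrite -card_draws -[RHS](cardsID (edges G)).
by rewrite (setIidPr (edges_sub_pairs G)).
Qed.

Lemma independent_pair (G : sgraph) (x y : G) :
  independent [set x; y] = ~~ adj x y.
Proof.
apply/forall_inP/idP => [indep | nadj_xy u].
  by move/forall_inP: (indep x (set21 x y)); apply; apply: set22.
rewrite !inE => /orP[] /eqP->; apply/forall_inP => v;
  by rewrite !inE => /orP[] /eqP->; rewrite ?adj_irrefl // adj_sym.
Qed.

Lemma indep_count2 (G : sgraph) : indep_count G 2 = #|nonedges G|.
Proof.
apply: eq_card => A; rewrite !inE andbC [RHS]andbC.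
case: (boolP (#|A| == 2)) => //= /cards2P[x [y] [_ ->]].
by rewrite independent_pair mem_edges_pair.
Qed.

Lemma indep_count0 (G : sgraph) : indep_count G 0 = 1.
Proof.
rewrite -(cards1 (set0 : {set G})); apply: eq_card => A.
rewrite !inE cards_eq0 andbC; case: eqVneq => //= ->.
by apply/forall_inP => x; rewrite inE.
Qed.

Lemma indep_count1 (G : sgraph) : indep_count G 1 = #|G|.
Proof.
rewrite -(bin1 #|G|) -card_draws; apply: eq_card => A.
rewrite !inE andbC; case: (boolP (#|A| == 1)) => //= /cards1P[x ->].
apply/forall_inP => u /set1P->; apply/forall_inP => v /set1P->.
by rewrite adj_irrefl.
Qed.

Lemma indep_count_iso (G H : sgraph) (j : nat) :
  graph_iso G H -> indep_count G j = indep_count H j.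
Proof.
case=> f bij_f adj_f; have inj_f := bij_inj bij_f.
have [g fK gK] := bij_f.
rewrite /indep_count -(card_imset _ (imset_inj inj_f)); apply: eq_card => A.
have -> : A = [set f x | x in [set g y | y in A]].
  by rewrite -imset_comp (eq_imset (g := id)) ?imset_id.
rewrite mem_imset; last exact: imset_inj.
set B := [set g y | y in A]; rewrite !inE card_imset //; congr (_ && _).
apply/forall_inP/forall_inP => [indep _ /imsetP[x xB ->] | indep x xB].
  apply/forall_inP => _ /imsetP[y yB ->]; rewrite adj_f.
  by move/forall_inP: (indep x xB); apply.
apply/forall_inP => y yB; rewrite -adj_f.
by move/forall_inP: (indep _ (imset_f f xB)); apply; apply: imset_f.
Qed.

(** The function [c] names the clique that each vertex belongs to; it is
    injective on independent sets, which therefore have at most two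
    elements. *)
Lemma indep_count_two_cliques (G : sgraph) (c : G -> bool) (j : nat) :
  (forall x y, x != y -> c x = c y -> adj x y) -> 2 < j ->
  indep_count G j = 0.
Proof.
move=> cliques lt2j; apply: eq_card0 => A; rewrite !inE.
apply/negP => /andP[/forall_inP indep /eqP cardA].
have inj_c : {in A &, injective c}.
  move=> x y xA yA eq_c; apply/eqP; apply: contraT => neq_xy.
  by move/forall_inP: (indep x xA) => /(_ y yA); rewrite cliques.
have := max_card [in [set c x | x in A]].
by rewrite card_in_imset // cardA card_bool leqNgt lt2j.
Qed.

(** The truncation in [indep_poly] loses nothing: no set has more than [#|G|]
    elements. *)
Lemma coef_indep_poly (R : nzRingType) (G : sgraph) (j : nat) :
  ((indep_poly R G)`_j = (indep_count G j)%:R)%R.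
Proof.
rewrite coef_poly; case: ltnP => // ltGj.
rewrite [indep_count G j]eq_card0 // => A; rewrite !inE.
by rewrite (ltn_eqF (leq_ltn_trans (max_card _) ltGj)) andbF.
Qed.

(** The difference of the two polynomials has nonnegative coefficients. *)
Lemma le_indep_poly (R : numDomainType) (G H : sgraph) (x : R) :
  (forall j, indep_count H j <= indep_count G j) ->
  (0 <= x -> (indep_poly R H).[x] <= (indep_poly R G).[x])%R.
Proof.
move=> leHG x_ge0; rewrite -subr_ge0 -hornerN -hornerD horner_coef.
apply: sumr_ge0 => j _; apply: mulr_ge0; last exact: exprn_ge0.
by rewrite coefB !coef_indep_poly subr_ge0 ler_nat.
Qed.

Lemma nonedges_add_edges (G : sgraph) (F : {set {set G}}) :
  nonedges (add_edges F) = nonedges G :\: F.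
Proof.
apply/setP => e; rewrite !inE.
case: (boolP (#|e| == 2)) => [/cards2P[x [y] [neq_xy ->]] | _]; last first.
  by rewrite !andbF.
have -> : ([set x; y] \in edges (add_edges F))
          = @adj G x y || ([set x; y] \in F).
  by rewrite (@mem_edges_pair (add_edges F)) /= /added_adj /= neq_xy.
by rewrite (@mem_edges_pair G) negb_or !andbT andbC.
Qed.

(** Inside each clique all pairs are adjacent and across none is, so the
    nonedges are parametrized by a choice of one end in each clique. *)
Lemma card_nonedges_two_complete (a b : nat) :
  #|nonedges (disjoint_union (complete_graph a) (complete_graph b))| = a * b.
Proof.
set G := disjoint_union _ _.
pose cross (p : 'I_a * 'I_b) : {set G} := [set inl p.1; inr p.2].
have inj_cross : injective cross.
  move=> [x y] [u v] eq_cross.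
  have: (inl x : G) \in cross (u, v) by rewrite -eq_cross set21.
  have: (inr y : G) \in cross (u, v) by rewrite -eq_cross set22.
  by rewrite !inE /= => /eqP[->]; rewrite orbF => /eqP[->].
transitivity #|[set cross p | p : 'I_a * 'I_b]|; last first.
  by rewrite card_imset // card_prod !card_ord.
apply: eq_card => e; apply/idP/imsetP => [|[[x y] _ ->]]; last first.
  by rewrite !inE cards2 mem_edges_pair.
rewrite !inE andbC => /andP[/cards2P[u [v] [neq_uv ->]]].
rewrite mem_edges_pair.
case: u v neq_uv => [x|x] [y|y] /= neq_xy nadj.
- by case/negP: nadj; apply: contraNneq neq_xy => ->.
- by exists (x, y).
- by exists (y, x) => //; rewrite setUC.
- by case/negP: nadj; apply: contraNneq neq_xy => ->.
Qed.

Lemma mul_uphalf_half (n : nat) : uphalf n * n./2 = n ^ 2 %/ 4.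
Proof.
rewrite uphalf_half -[in RHS](odd_double_half n) -muln2.
case: (odd n) (n./2) => k /=; last by rewrite !add0n expnMn mulnK // mulnn.
have -> : (1 + k * 2) ^ 2 = ((1 + k) * k) * 4 + 1 by ring.
by rewrite divnMDl // addn0.
Qed.

Theorem theorem2 (R : realType) (n m : nat) (H : sgraph)
  (hn : 2 <= n)
  (hm1 : 'C(n, 2) - n ^ 2 %/ 4 <= m)
  (hm2 : m <= 'C(n, 2))
  (hH : formed_by_adding
          (disjoint_union (complete_graph (uphalf n)) (complete_graph n./2))
          (m - ('C(n, 2) - n ^ 2 %/ 4)) H) :
  optimally_least R n m H /\
  indep_poly R H = (1 + n%:R *: 'X + ('C(n, 2)%:R - m%:R) *: 'X^2)%R.
Proof.
have [F [subF cardF iso]] := hH.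
set U := disjoint_union _ _ in F subF cardF iso.
have cardU : #|U| = n.
  by rewrite card_sum !card_ord uphalf_half -addnA addnn odd_double_half.
have nonU : #|nonedges U| = n ^ 2 %/ 4.
  by rewrite card_nonedges_two_complete mul_uphalf_half.
have le_n2 : n ^ 2 %/ 4 <= 'C(n, 2).
  by rewrite -nonU -cardU -card_edges_nonedges leq_addl.
have cardH : #|H| = n by case: iso => f /bij_eq_card <-.
have count2H : indep_count H 2 = 'C(n, 2) - m.
  rewrite -(indep_count_iso _ _ 2 iso) indep_count2 nonedges_add_edges.
  rewrite cardsD (setIidPr subF) nonU cardF; lia.
have count3H j : 2 < j -> indep_count H j = 0.
  move=> lt2j; rewrite -(indep_count_iso _ _ j iso).
  apply: (@indep_count_two_cliques (add_edges F)
            (fun u : U => if u is inl _ then true else false)) => //.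
  by move=> [x|x] [y|y] //= neq_xy _; apply/orP; left;
    apply: contraNneq neq_xy => ->.
have edgesH : #|edges H| = m.
  by have := card_edges_nonedges H; rewrite -indep_count2 count2H cardH; lia.
split; [split=> // G [cardG edgesG] x|].
  apply: le_indep_poly => -[|[|[|j]]].
  - by rewrite !indep_count0.
  - by rewrite !indep_count1 cardH cardG.
  - have := card_edges_nonedges G.
    by rewrite count2H indep_count2 cardG edgesG => <-; rewrite addKn.
  - by rewrite count3H.
apply/polyP => j.
rewrite coef_indep_poly !coefD coef1 !coefZ coefX coefXn.
case: j => [|[|[|j]]] /=.
- by rewrite indep_count0 !mulr0 !addr0.
- by rewrite indep_count1 cardH mulr1 mulr0 addr0 add0r.
- by rewrite count2H natrB // mulr0 mulr1 !add0r.
- by rewrite count3H // !mulr0 !addr0.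
Qed.
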